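(* Let $a,b,d$ be three pairwise coprime positive integers with $d<\min(a,b)$ and $d\nmid ab-a-b$, and let $S=\langle a,b\rangle/d$. Let $m\in\{1,\dots,d-1\}$ with $am+b\equiv0\pmod d$, $\alpha=m/d$ with continued fraction expansion $[0,a_1,\dots,a_r,1]$ and convergents $p_k/q_k$. Let $\tau=\frac{am+b}{d}$, $\mu_i=\tau q_i-ap_i$ for $i\in\{0,\dots,r\}$, $\beta=1-\left\{\frac{b-1+m}{d}\right\}$ with $\alpha$-numeration $(b_1,\dots,b_r)$, $B=\{i\in\{1,\dots,\lfloor r/2\rfloor\}: b_{2i}\neq0\}$, $f=ab-a-b$, $f_1=\frac fd-a(1-\beta)$ and $f_2=\frac fd-\frac bd\sum_{i=1}^r b_iq_{i-1}$. Then $$\mathrm{PF}(S)=\{f_1,f_2\}\cup\Big\{\frac fd+a\beta-j\mu_{2k-1}-\sum_{i=1}^{2k-1}b_i\mu_{i-1}:\ k\in B,\ j\in\{0,\dots,b_{2k}-1\}\Big\},$$ and $t(S)=2+\sum_{k=1}^{\lfloor r/2\rfloor}b_{2k}$.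
   Context: $\langle a,b\rangle=\{xa+yb:x,y\in\mathbb{N}\}$; $S/d=\{x\in\mathbb{N}:dx\in S\}$; $\mathrm{PF}(S)=\{x\in\mathbb{Z}\setminus S: x+s\in S\text{ for all nonzero }s\in S\}$ and $t(S)=\#\mathrm{PF}(S)$; $\{x\}$ is the fractional part. Continued fractions: $\alpha=[0,a_1,\dots,a_r,1]$ is the expansion of the rational $\alpha\in(0,1)$ with last partial quotient $1$; with $a_0=0$, $p_{-2}=0,p_{-1}=1,q_{-2}=1,q_{-1}=0$, $p_k=a_kp_{k-1}+p_{k-2}$, $q_k=a_kq_{k-1}+q_{k-2}$, the convergents are $p_k/q_k$ ($k\le r$), $q_{r+1}=d$; $\delta_k=(-1)^k(q_k\alpha-p_k)$. $\alpha$-numeration: $E_\alpha$ is the set of $(d_1,\dots,d_r)\in\mathbb{N}^r$ with $d_j\in\{0,\dots,a_j\}$ and such that $d_j=0$ implies either $d_i=0$ for all $i\geqslant j$ or ($j\ge2$ and $d_{j-1}=a_{j-1}$). Each $\beta\in\{k/d: 0\le k<d\}$ has a unique representation $\beta=\sum_{j=1}^r(-1)^{j-1}d_j\delta_{j-1}$ with $(d_j)\in E_\alpha$, its $\alpha$-numeration. *)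

(* Defs.v *)
From mathcomp Require Import all_boot all_order all_algebra.
From mathcomp Require Import boolp classical_sets functions cardinality.

Set Implicit Arguments.
Unset Strict Implicit.
Unset Printing Implicit Defensive.

Import Order.TTheory GRing.Theory Num.Theory.

Local Open Scope classical_set_scope.
Local Open Scope ring_scope.

Definition gen2 (a b : nat) : set nat :=
  [set n | exists x y : nat, n = (x * a + y * b)%N].

Definition semigroup_quot (S : set nat) (d : nat) : set nat := [set x | S (d * x)%N].

Definition in_int (S : set nat) (x : int) : Prop := exists2 n, S n & x = n%:Z.

Definition PF (S : set nat) : set int :=
  [set x | ~ in_int S x /\
           forall s : nat, S s -> s <> 0%N -> in_int S (x + s%:Z)].

Definition fracpart (x : rat) : rat := x - (Num.floor x)%:~R.

(* Partial quotients are given by a function c : nat -> nat, of which only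
   the values c 0, ..., c n are used in [c_0, ..., c_n]. Since 0^-1 = 0, the
   innermost term of the fold is c_n + 0^-1 = c_n. *)
Definition cf_value (c : nat -> nat) (n : nat) : rat :=
  foldr (fun x v => x%:R + v^-1) 0 (mkseq c n.+1).

Definition cf_expansion (alpha : rat) (r : nat) (c : nat -> nat) : Prop :=
  [/\ c 0%N = 0%N,
      forall i, (1 <= i <= r)%N -> (0 < c i)%N,
      c r.+1 = 1%N
    & alpha = cf_value c r.+1].

(* Solution of u_k = c_k u_{k-1} + u_{k-2} with index shifted by 2:
   cf_rec u v c k.+2 is u_k, where u_{-2} = u and u_{-1} = v. *)
Fixpoint cf_rec (u v : nat) (c : nat -> nat) (n : nat) : nat :=
  match n with
  | 0 => u
  | 1 => v
  | (n'.+1 as n1).+1 => (c n' * cf_rec u v c n1 + cf_rec u v c n')%N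
  end.

Definition cf_p (c : nat -> nat) (k : nat) : nat := cf_rec 0 1 c k.+2.
Definition cf_q (c : nat -> nat) (k : nat) : nat := cf_rec 1 0 c k.+2.

Definition cf_delta (alpha : rat) (c : nat -> nat) (k : nat) : rat :=
  (-1) ^+ k * ((cf_q c k)%:R * alpha - (cf_p c k)%:R).

(* The digits (e_1, ..., e_r) are the values of e at 1, ..., r; the other
   values of e are irrelevant. *)
Definition admissible (r : nat) (c e : nat -> nat) : Prop :=
  forall j, (1 <= j <= r)%N ->
    (e j <= c j)%N /\
    (e j = 0%N ->
       (forall i, (j <= i <= r)%N -> e i = 0%N) \/
       ((2 <= j)%N /\ e j.-1 = c j.-1)).

Definition alpha_numeration (alpha : rat) (r : nat) (c : nat -> nat)
    (beta : rat) (e : nat -> nat) : Prop :=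
  admissible r c e /\
  beta = \sum_(1 <= j < r.+1) (-1) ^+ j.-1 * (e j)%:R * cf_delta alpha c j.-1.

(* Main.v *)
Require Import Defs.
From mathcomp Require Import all_boot all_order all_algebra.
From mathcomp Require Import boolp classical_sets functions cardinality.
From mathcomp Require Import zify ring.

Set Implicit Arguments.
Unset Strict Implicit.
Unset Printing Implicit Defensive.

Import Order.TTheory GRing.Theory Num.Theory.

Local Open Scope classical_set_scope.
Local Open Scope ring_scope.

(** By the symmetry n |-> f - n of <a, b>, the pseudo-Frobenius numbers x of S
    correspond through f - d x = u a + v b to the componentwise minimal points
    (u, v) of the coset { (u, v) in N^2 | u = m v - d beta mod d } of the lattice
    { u = m v mod d }. These minimal points form a staircase of records, which
    the alpha-numeration of beta describes explicitly. Two points P, Q are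
    consecutive in the staircase because Q - P completes to a lattice basis
    with a vector coming from a (possibly intermediate) convergent of alpha,
    which is too long, by the bounds e_i <= a_i on the digits, for a further
    point of the coset to fit below both. *)

(** * Staircases *)

Lemma pair_le_anti (P R : int * int) :
  R.1 <= P.1 -> R.2 <= P.2 -> P.1 <= R.1 -> P.2 <= R.2 -> R = P.
Proof. by case: P R => [? ?] [? ?] /= *; congr pair; lia. Qed.

Definition minimal_point (T : int * int -> Prop) (P : int * int) : Prop :=
  T P /\ forall R, T R -> R.1 <= P.1 -> R.2 <= P.2 -> R = P.

(** Membership in [T] is kept separate: the corners are shown empty first, and nonnegativity of the
    records is then read off from the stair itself. *)
Definition stair_step (T : int * int -> Prop) (P Q : int * int) : Prop :=
  [/\ Q.1 < P.1, P.2 < Q.2 & forall R, T R -> R.1 < P.1 -> R.2 < Q.2 -> False].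

Fixpoint stair (T : int * int -> Prop) (P : int * int) (s : seq (int * int)) :=
  if s is Q :: s' then stair_step T P Q /\ stair T Q s' else True.

Lemma stair_cat T P s1 s2 :
  stair T P (s1 ++ s2) <-> stair T P s1 /\ stair T (last P s1) s2.
Proof.
elim: s1 P => [|Q s1 IH] P /=; first by tauto.
by rewrite IH; tauto.
Qed.

Lemma stair_monotone T P s Q :
  stair T P s -> Q \in s -> Q.1 < P.1 /\ P.2 < Q.2.
Proof.
elim: s P => [|Q1 s IH] P //= [[h1 h2 _] hs]; rewrite inE => /orP[/eqP->//|Qs].
by have [h3 h4] := IH _ hs Qs; split; [apply: lt_trans h3 h1 | apply: lt_trans h2 h4].
Qed.

Lemma stair_uniq T P s : stair T P s -> uniq (P :: s).
Proof.
elim: s P => [|Q s IH] P // hs; rewrite cons_uniq (IH Q) ?andbT; last by case: hs.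
by apply/negP => /(stair_monotone hs) []; rewrite ltxx.
Qed.

(** Walk up to the last stair point not higher than [R]. The corner before its successor is empty,
    so [R] is not to its left; the point is then below [R], and minimality identifies the two. At
    the end of the stair, abscissa 0 plays the role of the empty corner. *)
Lemma minimal_point_in_stair T P s R :
  stair T P s -> (forall Q, Q \in P :: s -> T Q) -> (last P s).1 = 0 ->
  minimal_point T R -> 0 <= R.1 -> P.2 <= R.2 -> R \in P :: s.
Proof.
elim: s P => [|Q s IH] P /= hs hT hl hR R0 hPR.
  rewrite inE; apply/eqP/esym; case: hR => _; apply=> //; first by apply: hT; rewrite inE.
  by rewrite hl.
case: hs => -[h1 h2 h3] hs.
have [hQ|hQ] := leP Q.2 R.2.
  rewrite inE; apply/orP; right; apply: IH => // Q' Q's.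
  by apply: hT; rewrite inE Q's orbT.
rewrite inE; apply/orP; left; apply/eqP/esym.
case: hR => TR; apply=> //; first by apply: hT; rewrite inE eqxx.
by rewrite leNgt; apply/negP => hlt; apply: (h3 R).
Qed.

(** A point of [T] below [Q] and distinct from it would fall into the empty corner of the step whose
    ordinates enclose its own. *)
Lemma stair_minimal_point T P s Q R :
  stair T P s -> (last P s).1 = 0 -> Q \in P :: s ->
  T R -> 0 <= R.1 -> P.2 <= R.2 -> R.1 <= Q.1 -> R.2 <= Q.2 -> R = Q.
Proof.
elim: s P => [|Q1 s IH] P /= hs hl.
  rewrite inE => /eqP-> TR R0 h1 h2 h3.
  by apply: pair_le_anti => //; rewrite hl.
case: hs => -[h1 h2 h3] hs.
rewrite inE => /orP[/eqP->|Qs] TR R0 hPR hRQ1 hRQ2.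
  apply: pair_le_anti => //; rewrite leNgt; apply/negP => hlt.
  by apply: (h3 R) => //; apply: le_lt_trans hRQ2 h2.
have [hQ|hQ] := leP Q1.2 R.2; first exact: (IH Q1).
exfalso; apply: (h3 R) => //.
apply: le_lt_trans hRQ1 (le_lt_trans _ h1).
by move: Qs; rewrite inE => /orP[/eqP->//|/(stair_monotone hs)[/ltW]].
Qed.

(* The vectors (-A, C) and (D, q) span the lattice { (u, v) | u = m v mod d },
   so R - P is an integer combination of them. *)
Lemma lattice_gap (d m A C D q : int) (P R : int * int) :
  0 < d -> 0 <= A -> 0 <= C -> 0 < D -> 0 < q -> A * q + C * D = d ->
  (d %| A + m * C)%Z -> (d %| D - m * q)%Z ->
  (d %| (R.1 - P.1) - m * (R.2 - P.2))%Z ->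
  P.1 - A < D -> P.2 < q -> 0 <= R.1 -> 0 <= R.2 ->
  R.1 < P.1 -> R.2 < P.2 + C -> False.
Proof.
case: P R => [u v] [s t] /= d0 A0 C0 D0 q0 det /dvdzP[z1 e1] /dvdzP[z2 e2].
move=> /dvdzP[z3 e3] hu hv s0 t0 hs ht.
pose X := s - u; pose Y := t - v.
have eX : X = m * Y + z3 * d by rewrite /X /Y; lia.
have eD : D = m * q + z2 * d by lia.
have eA : A = - m * C + z1 * d by lia.
(* Cramer's rule for (X, Y) in the basis (-A, C), (D, q): both numerators are divisible by d, and
   [x], [y] are the quotients written out. *)
pose x := z2 * Y - z3 * q.
pose y := z3 * C + Y * z1.
have ex : X * q - Y * D = - x * d by rewrite eX eD /x; ring.
have ey : X * C + Y * A = y * d by rewrite eX eA /y; ring.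
have hX : X = - x * A + y * D.
  apply: (mulIf (lt0r_neq0 d0)); transitivity (- x * d * A + y * d * D); last by ring.
  by rewrite -ex -ey -det; ring.
have hY : Y = x * C + y * q.
  apply: (mulIf (lt0r_neq0 d0)); transitivity (y * d * q - (- x * d) * C); last by ring.
  by rewrite -ex -ey -det; ring.
have hX0 : X < 0 by rewrite /X; lia.
have hY0 : Y < C by rewrite /Y; lia.
have hXD : - A - D < X by rewrite /X; lia.
have hYq : - q < Y by rewrite /Y; lia.
clearbody x y X Y => {e1 e2 e3 eX eD eA ex ey det hu hv s0 t0 hs ht}.
(* Each sign pattern breaks one of the four bounds: x >= 1 and y >= 0 give Y >= C; x >= 1 and y < 0
   give X <= -A - D; x <= 0 and y >= 0 give X >= 0; x <= 0 and y < 0 give Y <= -q. *)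
have [x1|x1] := leP 1 x.
  have hA : 0 <= (x - 1) * A by apply: mulr_ge0 => //; lia.
  have hC : 0 <= (x - 1) * C by apply: mulr_ge0 => //; lia.
  have [y0|y0] := leP 0 y.
    by have := mulr_ge0 y0 (ltW q0); lia.
  by have : 0 <= (- 1 - y) * D by [apply: mulr_ge0; lia]; lia.
have hA : 0 <= - x * A by apply: mulr_ge0 => //; lia.
have hC : 0 <= - x * C by apply: mulr_ge0 => //; lia.
have [y0|y0] := leP 0 y.
  by have := mulr_ge0 y0 (ltW D0); lia.
by have : 0 <= (- 1 - y) * q by [apply: mulr_ge0; lia]; lia.
Qed.

(** * The staircase of a numeration *)

Section Staircase.

(** [w n] stands for (-1)^(n-1) d delta_(n-1), [Q n] for q_(n-1), and [beta] for d times the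
    rational beta. The shift by one pairs the digit [e n] with index n. *)
Variables (d m beta : int) (r : nat) (c e : nat -> nat) (w Q : nat -> int).
Hypothesis d_gt0 : 0 < d.
Hypothesis w0 : w 0 = - d.
Hypothesis wS : forall n, w n.+2 = (c n.+1)%:Z * w n.+1 + w n.
Hypothesis Q0 : Q 0 = 0.
Hypothesis Q1 : Q 1 = 1.
Hypothesis QS : forall n, Q n.+2 = (c n.+1)%:Z * Q n.+1 + Q n.
Hypothesis w_lattice : forall n, (d %| w n - m * Q n)%Z.
Hypothesis w_even : forall k, (k.*2 <= r.+1)%N -> w k.*2 < 0.
Hypothesis w_odd : forall k, (k.*2.+1 <= r.+1)%N -> 0 < w k.*2.+1.
Hypothesis c_gt0 : forall n, (1 <= n <= r)%N -> (0 < c n)%N.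
Hypothesis e_le : forall n, (e n <= c n)%N.
Hypothesis e0 : e 0 = 0%N.
Hypothesis e1 : (0 < e 1)%N.
Hypothesis e_out : forall n, (r < n)%N -> e n = 0%N.
Hypothesis e_adm : forall j, (1 <= j <= r)%N -> e j = 0%N ->
  (forall i, (j <= i)%N -> e i = 0%N) \/ e j.-1 = c j.-1.
Hypothesis betaE : beta = \sum_(i < r.+1) (e i)%:Z * w i.

Definition coset_points (R : int * int) : Prop :=
  [/\ 0 <= R.1, 0 <= R.2 & (d %| R.1 - m * R.2 + beta)%Z].

(** By [betaE] this is minus the tail of the expansion of [beta] from digit n on, hence 0 past r. *)
Definition abscissa n : int := - beta + \sum_(i < n) (e i)%:Z * w i.
Definition ordinate n : int := \sum_(i < n) (e i)%:Z * Q i.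
Definition ladder k (j : nat) : int * int :=
  (abscissa k.*2 + j%:Z * w k.*2, ordinate k.*2 + j%:Z * Q k.*2).
(* The last record reached with the digits e_1, ..., e_2k: it is
   [ladder k (e k.*2).-1] unless e_2k = 0. *)
Definition last_record k : int * int :=
  (abscissa k.*2.+1 - w k.*2, ordinate k.*2.+1 - Q k.*2).
Definition records k : seq (int * int) :=
  [seq ladder i j | i <- iota 1 k, j <- iota 0 (e i.*2)].

Local Notation U := abscissa.
Local Notation V := ordinate.
Local Notation T := coset_points.

Lemma abscissaS n : U n.+1 = U n + (e n)%:Z * w n.
Proof. by rewrite /U big_ord_recr addrA. Qed.

Lemma ordinateS n : V n.+1 = V n + (e n)%:Z * Q n.
Proof. by rewrite /V big_ord_recr. Qed.

(** Unimodularity of consecutive convergents, scaled by d: neighbouring vectors (w n, Q n) form a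
    basis of the lattice. *)
Lemma det_even k : w k.*2.+1 * Q k.*2 - w k.*2 * Q k.*2.+1 = d.
Proof.
elim: k => [|k IH]; first by rewrite /= w0 Q0 Q1; ring.
by rewrite doubleS !(wS, QS) -IH; ring.
Qed.

Lemma det_odd k : w k.*2.+1 * Q k.*2.+2 - w k.*2.+2 * Q k.*2.+1 = d.
Proof. by rewrite -(det_even k) wS QS; ring. Qed.

Lemma Q_ge0 n : 0 <= Q n.
Proof.
suff: 0 <= Q n /\ 0 <= Q n.+1 by case.
elim: n => [|n [IH1 IH2]]; first by rewrite Q0 Q1.
by split=> //; rewrite QS addr_ge0 // mulr_ge0.
Qed.

Lemma Q_gt0 n : (n <= r)%N -> 0 < Q n.+1.
Proof.
elim: n => [|n IH] h; first by rewrite Q1.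
rewrite QS; apply: ltr_wpDr; first exact: Q_ge0.
by apply: mulr_gt0; [have := @c_gt0 n.+1; lia | apply: IH; lia].
Qed.

(** The digit bound e_n <= c_n propagates through the recurrence of [Q]. This supplies the condition
    P.2 < q of [lattice_gap]. *)
Lemma ordinate_bound n : V n.+1 <= Q n.+1 + Q n - 1.
Proof.
elim: n => [|n IH]; first by rewrite ordinateS /V big_ord0 e0 Q0 Q1; lia.
rewrite ordinateS QS.
have : (e n.+1)%:Z * Q n.+1 <= (c n.+1)%:Z * Q n.+1.
  by apply: ler_wpM2r; [apply: Q_ge0 | rewrite lez_nat].
lia.
Qed.

Lemma abscissa_end n : (r < n)%N -> U n = 0.
Proof.
elim: n => // n IH; rewrite ltnS leq_eqVlt => /orP[/eqP<-|h].
  by rewrite /U betaE addNr.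
by rewrite abscissaS IH // e_out // mul0r addr0.
Qed.

(** Descending induction from the end, where the abscissa is 0. Going back over two digits, the even
    one adds at most -c_(2k+2) w_(2k+2), which turns w_(2k+3) into w_(2k+1), and the odd one adds
    nothing positive. This supplies P.1 - A < D in [lattice_gap]. *)
Lemma abscissa_bound k : (k <= r./2)%N -> U k.+1.*2 < w k.*2.+1.
Proof.
move=> hk; rewrite -(subKn hk); elim: (r./2 - k)%N (leq_subr k r./2) => [|i IH] hi.
  by rewrite subn0 abscissa_end; [apply: w_odd; lia | lia].
set k' := (r./2 - i.+1)%N.
have e2 : (r./2 - i = k'.+1)%N by rewrite /k'; lia.
have {IH} := IH (ltnW hi); rewrite e2 => IH.
have hk' : (k'.+1 <= r./2)%N by rewrite /k'; lia.
have e4 : U k'.+2.*2 = U k'.+1.*2 + (e k'.+1.*2)%:Z * w k'.+1.*2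
    + (e k'.+1.*2.+1)%:Z * w k'.+1.*2.+1 by rewrite doubleS !abscissaS.
have hw : w k'.+1.*2 = (c k'.*2.+1)%:Z * w k'.*2.+1 + w k'.*2 by rewrite doubleS wS.
have hw' : w k'.+1.*2.+1 = (c k'.+1.*2)%:Z * w k'.+1.*2 + w k'.*2.+1 by rewrite doubleS wS.
have w2 := @w_even k'.+1 ltac:(lia).
have w3 := @w_odd k'.+1 ltac:(lia).
have h1 : 0 <= ((c k'.+1.*2)%:Z - (e k'.+1.*2)%:Z) * - w k'.+1.*2.
  by apply: mulr_ge0; [have := e_le k'.+1.*2; lia | lia].
have h2 : 0 <= (e k'.+1.*2.+1)%:Z * w k'.+1.*2.+1 by apply: mulr_ge0; lia.
lia.
Qed.

Lemma lattice_partial n : (d %| U n - m * V n + beta)%Z.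
Proof.
elim: n => [|n IH]; first by rewrite /U /V !big_ord0 mulr0 subr0 addr0 addNr dvdz0.
have -> : U n.+1 - m * V n.+1 + beta =
    U n - m * V n + beta + (e n)%:Z * (w n - m * Q n).
  by rewrite abscissaS ordinateS; ring.
by rewrite rpredD // dvdz_mull.
Qed.

Lemma lattice_ladder k j : (d %| (ladder k j).1 - m * (ladder k j).2 + beta)%Z.
Proof.
have -> : (ladder k j).1 - m * (ladder k j).2 + beta =
    U k.*2 - m * V k.*2 + beta + j%:Z * (w k.*2 - m * Q k.*2) by rewrite /=; ring.
by rewrite rpredD ?lattice_partial // dvdz_mull.
Qed.

Lemma lattice_last_record k :
  (d %| (last_record k).1 - m * (last_record k).2 + beta)%Z.
Proof.
have -> : (last_record k).1 - m * (last_record k).2 + beta =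
    U k.*2.+1 - m * V k.*2.+1 + beta - (w k.*2 - m * Q k.*2) by rewrite /=; ring.
by rewrite rpredB ?lattice_partial.
Qed.

Lemma lattice_diff (P R : int * int) :
  (d %| P.1 - m * P.2 + beta)%Z -> (d %| R.1 - m * R.2 + beta)%Z ->
  (d %| (R.1 - P.1) - m * (R.2 - P.2))%Z.
Proof.
move=> hP hR.
have -> : R.1 - P.1 - m * (R.2 - P.2) =
   (R.1 - m * R.2 + beta) - (P.1 - m * P.2 + beta) by ring.
exact: rpredB.
Qed.

(** The step vector is the intermediate convergent (w_2k, Q_2k) + e_(2k+1) (w_(2k+1), Q_(2k+1)), and
    (w_(2k+1), Q_(2k+1)) completes it to a basis. *)
Lemma last_record_step k :
  (k <= r./2)%N -> stair_step T (last_record k) (ladder k.+1 0).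
Proof.
move=> hk.
have we := @w_even k ltac:(lia); have wo := @w_odd k ltac:(lia).
have eu : U k.+1.*2 = U k.*2.+1 + (e k.*2.+1)%:Z * w k.*2.+1 by rewrite doubleS abscissaS.
have ev : V k.+1.*2 = V k.*2.+1 + (e k.*2.+1)%:Z * Q k.*2.+1 by rewrite doubleS ordinateS.
have Ub := abscissa_bound hk; have Vb := ordinate_bound k.*2.
have Qo := @Q_gt0 k.*2 ltac:(lia); have Qe := Q_ge0 k.*2.
(* As e_(2k+1) <= c_(2k+1), the step's abscissa is at most w_(2k+2) < 0; past r the digit is 0 and
   w_2k < 0 remains. *)
have hA : 0 < - w k.*2 - (e k.*2.+1)%:Z * w k.*2.+1.
  have [hr|hr] := leqP k.*2.+1 r; last by rewrite e_out // mul0r subr0 oppr_gt0.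
  have := @w_even k.+1 ltac:(lia); rewrite doubleS wS.
  have : 0 <= ((c k.*2.+1)%:Z - (e k.*2.+1)%:Z) * w k.*2.+1.
    by apply: mulr_ge0; [have := e_le k.*2.+1; lia | lia].
  lia.
have hC : 0 < Q k.*2 + (e k.*2.+1)%:Z * Q k.*2.+1.
  (* For k = 0, [Q 0] vanishes and the ordinate grows only because e_1 > 0. *)
  case: k hk {we wo eu ev Ub Vb Qo hA} Qe => [|k] hk Qe; first by rewrite double0 Q0 Q1; lia.
  apply: ltr_wpDr; first by rewrite mulr_ge0 // Q_ge0.
  by rewrite doubleS; apply: Q_gt0; lia.
split; rewrite /= ?mul0r ?addr0; [lia | lia |].
move=> R [R1 R2 hR] hl1 hl2.
apply: (@lattice_gap d m (- w k.*2 - (e k.*2.+1)%:Z * w k.*2.+1)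
  (Q k.*2 + (e k.*2.+1)%:Z * Q k.*2.+1) (w k.*2.+1) (Q k.*2.+1) (last_record k) R) => //=.
- exact: ltW.
- exact: ltW.
- by rewrite -(det_even k); ring.
- have -> : - w k.*2 - (e k.*2.+1)%:Z * w k.*2.+1 +
     m * (Q k.*2 + (e k.*2.+1)%:Z * Q k.*2.+1) =
     - (w k.*2 - m * Q k.*2) - (e k.*2.+1)%:Z * (w k.*2.+1 - m * Q k.*2.+1) by ring.
  by rewrite rpredB ?rpredN ?dvdz_mull.
- exact: (lattice_diff (lattice_last_record k) hR).
- lia.
- lia.
- lia.
Qed.

(** Here the step vector is the convergent (w_(2k+2), Q_(2k+2)) and the completing vector is
    intermediate, with coefficient j + 1; its abscissa stays positive since j + 1 < e_(2k+2) <=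
    c_(2k+2). *)
Lemma ladder_step k j : (k < r./2)%N -> (j.+1 < e k.+1.*2)%N ->
  stair_step T (ladder k.+1 j) (ladder k.+1 j.+1).
Proof.
move=> hk hj.
have we := @w_even k.+1 ltac:(lia); have wo := @w_odd k ltac:(lia).
have Ub := abscissa_bound (ltnW hk); have Vb := ordinate_bound k.*2.+1.
have Qo := @Q_gt0 k.*2 ltac:(lia); have Qe := @Q_gt0 k.*2.+1 ltac:(lia).
have hD : 0 < w k.*2.+1 + (j.+1)%:Z * w k.*2.+2.
  have := @w_odd k.+1 ltac:(lia); rewrite doubleS wS -doubleS.
  have : 0 <= ((c k.+1.*2)%:Z - (j.+1)%:Z) * - w k.+1.*2.
    by apply: mulr_ge0; [have := e_le k.+1.*2; lia | lia].
  by rewrite doubleS; lia.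
have hq : 0 < Q k.*2.+1 + (j.+1)%:Z * Q k.*2.+2.
  by apply: ltr_wpDr => //; rewrite mulr_ge0 ?Q_ge0.
rewrite -doubleS in Qe Vb.
split; rewrite /= ?doubleS -?doubleS; [lia | lia |].
move=> R [R1 R2 hR] hl1 hl2.
rewrite -doubleS in hD hq.
apply: (@lattice_gap d m (- w k.+1.*2) (Q k.+1.*2) (w k.*2.+1 + (j.+1)%:Z * w k.+1.*2)
  (Q k.*2.+1 + (j.+1)%:Z * Q k.+1.*2) (ladder k.+1 j) R) => //=.
- lia.
- lia.
- by rewrite -(det_odd k) doubleS; ring.
- have -> : - w k.+1.*2 + m * Q k.+1.*2 = - (w k.+1.*2 - m * Q k.+1.*2) by ring.
  by rewrite rpredN.
- have -> : w k.*2.+1 + (j.+1)%:Z * w k.+1.*2 - m * (Q k.*2.+1 + (j.+1)%:Z * Q k.+1.*2) =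
     (w k.*2.+1 - m * Q k.*2.+1) + (j.+1)%:Z * (w k.+1.*2 - m * Q k.+1.*2) by ring.
  by rewrite rpredD ?dvdz_mull.
- exact: (lattice_diff (lattice_ladder k.+1 j) hR).
- lia.
- lia.
- lia.
Qed.

Lemma ladder_stair k n P : (k < r./2)%N -> (n < e k.+1.*2)%N ->
  stair_step T P (ladder k.+1 0) ->
  stair T P [seq ladder k.+1 j | j <- iota 0 n.+1] /\
  last P [seq ladder k.+1 j | j <- iota 0 n.+1] = ladder k.+1 n.
Proof.
move=> hk hn hP; elim: n hn => [|n IH] hn; first by [].
have [h1 h2] := IH (ltnW hn).
rewrite -(addn1 n.+1) iotaD map_cat stair_cat last_cat h2 add0n; split=> //; split=> //.
by split=> //; apply: ladder_step.
Qed.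

Lemma recordsS k :
  records k.+1 = records k ++ [seq ladder k.+1 j | j <- iota 0 (e k.+1.*2)].
Proof.
by rewrite /records -[in LHS](addn1 k) iotaD allpairs_cat /= cats0 add1n.
Qed.

(** The second alternative covers an expansion that has already ended, where only the point with
    abscissa 0 is still to come. A nonzero e_(2k+2) appends a ladder ending at the new last record;
    a zero digit is settled by admissibility. *)
Lemma records_stair k : (k <= r./2)%N ->
  let P := last (last_record 0) (records k) in
  stair T (last_record 0) (records k) /\
  (P = last_record k \/
   stair_step T P (ladder (r./2).+1 0) /\ forall i, (k.*2 <= i)%N -> e i = 0%N).
Proof.
elim: k => [|k IH] hk /=; first by split=> //; left.
have [h1 h2] := IH (ltnW hk); rewrite recordsS stair_cat last_cat.
case: h2 => [h2|[h2 h3]]; last first.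
  rewrite h3 ?cats0 /=; last by rewrite leq_double.
  by split=> //; right; split=> // i hi; apply: h3; lia.
have hstep := last_record_step (ltnW hk).
rewrite h2; case E : (e k.+1.*2) => [|n].
  split=> //=; have hk2 : (1 <= k.+1.*2 <= r)%N by lia.
  case: (e_adm hk2 E) => [hz|hc].
    right; split; last exact: hz.
    have hU n : (k.+1.*2 <= n)%N -> U n = U k.+1.*2 /\ V n = V k.+1.*2.
      elim: n => // n IHn; rewrite leq_eqVlt => /orP[/eqP<-//|hn].
      have [i1 i2] := IHn hn.
      by rewrite abscissaS ordinateS i1 i2 hz // !mul0r !addr0.
    have -> : ladder (r./2).+1 0 = ladder k.+1 0; last exact: hstep.
    by rewrite /ladder !mul0r !addr0; have [-> ->] := hU (r./2).+1.*2 ltac:(lia).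
  (* A full digit e_(2k+1) = c_(2k+1) followed by 0 creates no record: w_(2k+2) = c_(2k+1) w_(2k+1)
     + w_2k, and likewise for [Q], so the old and new last records coincide. *)
  left; move: hc; rewrite doubleS /= => hc.
  rewrite /last_record doubleS !abscissaS !ordinateS -doubleS E hc doubleS wS QS.
  by congr pair; ring.
have [h4 h5] := @ladder_stair k n _ hk ltac:(by rewrite E) hstep.
split=> //; left; rewrite h5 /ladder /last_record !abscissaS !ordinateS E.
by congr pair; rewrite intS; ring.
Qed.

Lemma full_stair :
  stair T (last_record 0) (rcons (records r./2) (ladder (r./2).+1 0)).
Proof.
have [h1 h2] := records_stair (leqnn r./2).
rewrite -cats1 stair_cat; split=> //; split=> //.
by case: h2 => [->|[]//]; apply: last_record_step.
Qed.

(** Along the stair abscissas decrease to 0 and ordinates increase from 0, so all coordinates are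
    nonnegative. *)
Lemma full_stair_points P :
  P \in last_record 0 :: rcons (records r./2) (ladder (r./2).+1 0) -> T P.
Proof.
have e3 : (ladder (r./2).+1 0).1 = 0 by rewrite /= mul0r addr0 abscissa_end //; lia.
have e2 : (last_record 0).2 = 0 by rewrite /= ordinateS /V big_ord0 e0 Q0; lia.
have hs := full_stair.
move=> hP; split.
- move: hs; rewrite -cats1 => hs.
  have : P \in ladder (r./2).+1 0 :: (last_record 0 :: records r./2).
    by move: hP; rewrite -rcons_cons mem_rcons.
  rewrite inE => /orP[/eqP->|]; first by rewrite e3.
  move=> hP'; apply: ltW; rewrite -e3.
  elim: (records _) (last_record 0) P hs hP' {hP} => [|R s IH] R0 P /=.
    by case=> -[h _ _] _; rewrite inE => /eqP->.
  case=> -[h _ _] hs; rewrite inE => /orP[/eqP->|]; last exact: IH.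
  by apply: lt_trans h; apply: (IH R R hs); rewrite inE eqxx.
- move: hP; rewrite inE => /orP[/eqP->|]; first by rewrite e2.
  by move=> /(stair_monotone hs)[_ /ltW]; rewrite e2.
- move: hP; rewrite inE mem_rcons inE => /orP[/eqP->|/orP[/eqP->|]].
  + exact: lattice_last_record.
  + exact: lattice_ladder.
  + by case/allpairsPdep=> k [j [_ _ ->]]; apply: lattice_ladder.
Qed.

Lemma minimal_pointsE P :
  minimal_point T P <->
  P \in last_record 0 :: rcons (records r./2) (ladder (r./2).+1 0).
Proof.
have e3 : (last (last_record 0) (rcons (records r./2) (ladder (r./2).+1 0))).1 = 0.
  by rewrite last_rcons /= mul0r addr0 abscissa_end //; lia.
have e2 : (last_record 0).2 = 0 by rewrite /= ordinateS /V big_ord0 e0 Q0; lia.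
split=> [hP|hP].
  have [h1 h2 _] := hP.1.
  by apply: minimal_point_in_stair hP h1 _; rewrite ?e2 //; [apply: full_stair | apply: full_stair_points].
split; first exact: full_stair_points.
move=> R TR h1 h2; have [R1 R2 _] := TR.
by apply: (stair_minimal_point full_stair e3 hP TR R1) => //; rewrite e2.
Qed.

Lemma minimal_points_uniq :
  uniq (last_record 0 :: rcons (records r./2) (ladder (r./2).+1 0)).
Proof. exact: stair_uniq full_stair. Qed.

Lemma size_minimal_points :
  size (last_record 0 :: rcons (records r./2) (ladder (r./2).+1 0)) =
  (2 + \sum_(1 <= k < (r./2).+1) e k.*2)%N.
Proof.
rewrite /= size_rcons size_allpairs_dep sumnE big_map /index_iota subn1 /= add2n.
by congr _.+2; apply: eq_bigr => k _; rewrite size_iota.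
Qed.

End Staircase.

(** * Pseudo-Frobenius numbers as minimal points *)

Definition representable (a b : nat) (n : int) : Prop :=
  exists u v : int, [/\ 0 <= u, 0 <= v & n = u * a%:Z + v * b%:Z].

Lemma reduced_representation (a b : nat) (n : int) :
  (0 < b)%N -> coprime a b ->
  exists u v : int, [/\ 0 <= u, u < b%:Z & n = u * a%:Z + v * b%:Z].
Proof.
move=> b0 cab; have [s [t st]] := Bezoutz a%:Z b%:Z.
have {}st : s * a%:Z + t * b%:Z = 1.
  by rewrite st /gcdz !absz_nat; move/eqP: cab => ->.
exists (n * s %% b%:Z)%Z, (n * t + (n * s %/ b%:Z)%Z * a%:Z); split.
- by apply: modz_ge0; lia.
- by apply: ltz_pmod; lia.
have e1 := divz_eq (n * s) b%:Z.
transitivity (n * (s * a%:Z + t * b%:Z)); first by rewrite st mulr1.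
rewrite mulrDr mulrA [in LHS]e1; ring.
Qed.

(** Two representations differ by k (b, -a); k >= 1 makes t negative and k <= -1 makes s
    negative. *)
Lemma representation_unique (a b : nat) (u v s t : int) :
  coprime a b -> (0 < a)%N -> (0 < b)%N ->
  0 <= u -> u < b%:Z -> 0 <= v -> v < a%:Z -> 0 <= s -> 0 <= t ->
  u * a%:Z + v * b%:Z = s * a%:Z + t * b%:Z -> u = s /\ v = t.
Proof.
move=> cab a0 b0 u0 ub v0 va s0 t0 E.
have : (b%:Z %| s - u)%Z.
  rewrite -(@Gauss_dvdzr _ a%:Z); last by rewrite coprimez_sym coprimezE.
  by apply/dvdzP; exists (v - t); lia.
case/dvdzP => k ek; have es : s = u + k * b%:Z by lia.
have et : t = v - k * a%:Z.
  apply: (mulIf (_ : b%:Z != 0)); first by lia.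
  have -> : t * b%:Z = u * a%:Z + v * b%:Z - s * a%:Z by lia.
  by rewrite es; ring.
have [k1|k1] := leP 1 k.
  by have : 0 <= (k - 1) * a%:Z by [apply: mulr_ge0; lia]; lia.
have [k2|k2] := leP k (-1).
  by have : 0 <= (- 1 - k) * b%:Z by [apply: mulr_ge0; lia]; lia.
have k0 : k = 0 by lia.
by rewrite es et k0; split; ring.
Qed.

(** If n and f - n were both representable, (u+s+1) a + (v+t+1) b = ab with b dividing u+s+1 > 0,
    which is too large. Conversely, reduce u modulo b; a negative v then gives coefficients b-1-u
    and -1-v for f - n. *)
Lemma representable_symmetry (a b : nat) (n : int) :
  (0 < a)%N -> (0 < b)%N -> coprime a b ->
  representable a b n <->
  ~ representable a b (a%:Z * b%:Z - a%:Z - b%:Z - n).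
Proof.
move=> a0 b0 cab; split.
  case=> u [v [u0 v0 ->]] [s [t [s0 t0 E]]].
  have : (b%:Z %| u + s + 1)%Z.
    rewrite -(@Gauss_dvdzr _ a%:Z); last by rewrite coprimez_sym coprimezE.
    by apply/dvdzP; exists (a%:Z - (v + t + 1)); lia.
  case/dvdzP => k ek.
  have k1 : 1 <= k.
    rewrite leNgt; apply/negP => k1.
    by have : 0 <= - k * b%:Z by [apply: mulr_ge0; lia]; lia.
  have h1 : 0 <= (k - 1) * (a%:Z * b%:Z) by apply: mulr_ge0; [lia | rewrite mulr_ge0].
  have h2 : (u + s + 1) * a%:Z = k * (a%:Z * b%:Z) by rewrite ek; ring.
  have h3 : 0 < (v + t + 1) * b%:Z by apply: mulr_gt0; lia.
  lia.
move=> hn; have [u [v [u0 ub E]]] := @reduced_representation a b n b0 cab.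
have [v0|v0] := leP 0 v; first by exists u, v.
case: hn; exists (b%:Z - 1 - u), (- 1 - v); split; [lia | lia |].
by rewrite E; ring.
Qed.

Lemma in_int_quotP (a b d : nat) (x : int) : (0 < a)%N -> (0 < b)%N -> (0 < d)%N ->
  in_int (semigroup_quot (gen2 a b) d) x <-> representable a b (d%:Z * x).
Proof.
move=> a0 b0 d0; split.
  case=> n [s [t E]] ->; exists s%:Z, t%:Z; split=> //.
  by rewrite -!PoszM -PoszD E.
case=> u [v [u0 v0 E]].
have x0 : 0 <= x.
  rewrite -(@pmulr_rge0 _ d%:Z) ?E; last by lia.
  by rewrite addr_ge0 // mulr_ge0.
case: x x0 E => // n _ E; exists n => //.
case: u v u0 v0 E => [u|//] [v|//] _ _ E; exists u, v.
by apply/eqP; rewrite -eqz_nat PoszD !PoszM E.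
Qed.

(** Lowering a coordinate by d stays in the coset. As d < min(a, b), minimal points are therefore
    reduced coefficient pairs, to which [representation_unique] applies. *)
Lemma minimal_point_bounded (d m beta : int) P : 0 < d ->
  minimal_point (coset_points d m beta) P -> P.1 < d /\ P.2 < d.
Proof.
move=> d_gt0 [[P1 P2 hP] hmin]; split; rewrite ltNge; apply/negP => h.
  have := hmin (P.1 - d, P.2); case: P {hmin} P1 P2 hP h => u v /= P1 P2 hP h hmin.
  have [] : (u - d, v) = (u, v); last by lia.
  apply: hmin => /=; [|lia|lia].
  split=> /=; [lia|lia|].
  have -> : u - d - m * v + beta = (u - m * v + beta) - d by ring.
  by rewrite rpredB.
have := hmin (P.1, P.2 - d); case: P {hmin} P1 P2 hP h => u v /= P1 P2 hP h hmin.
have [] : (u, v - d) = (u, v); last by lia.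
apply: hmin => /=; [|lia|lia].
split=> /=; [lia|lia|].
have -> : u - m * (v - d) + beta = (u - m * v + beta) + m * d by ring.
by rewrite rpredD // dvdz_mull.
Qed.

Section PseudoFrobenius.

Variables (a b d m : nat) (beta : int).
Hypothesis a_gt0 : (0 < a)%N.
Hypothesis b_gt0 : (0 < b)%N.
Hypothesis d_gt0 : (0 < d)%N.
Hypothesis coprime_ab : coprime a b.
Hypothesis coprime_ad : coprime a d.
Hypothesis d_lt_a : (d < a)%N.
Hypothesis d_lt_b : (d < b)%N.
Hypothesis m_def : (d%:Z %| a%:Z * m%:Z + b%:Z)%Z.
Hypothesis beta_def : (d%:Z %| beta + b%:Z - 1 + m%:Z)%Z.

Let f : int := a%:Z * b%:Z - a%:Z - b%:Z.
Let S := semigroup_quot (gen2 a b) d.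
Let T := coset_points d%:Z m%:Z beta.

(** Multiply by a, a unit modulo d, and substitute am = -b and beta = 1 - b - m modulo d. *)
Lemma coset_congruence (u v : int) :
  (d%:Z %| u - m%:Z * v + beta)%Z = (d%:Z %| f - u * a%:Z - v * b%:Z)%Z.
Proof.
rewrite -(@Gauss_dvdzr _ a%:Z); last by rewrite coprimez_sym coprimezE.
rewrite -[RHS]rpredN.
have -> : a%:Z * (u - m%:Z * v + beta) = - (f - u * a%:Z - v * b%:Z)
    + (a%:Z * (beta + b%:Z - 1 + m%:Z) - (v + 1) * (a%:Z * m%:Z + b%:Z)).
  by rewrite /f; ring.
by rewrite rpredDr // rpredB ?dvdz_mull.
Qed.

(* By the symmetry of <a, b>, x lies outside S iff f - d x = u a + v b with
   u, v >= 0, and adding an element of S to x subtracts an element of the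
   lattice from (u, v). *)
Lemma PF_minimal_point (x : int) :
  PF S x <-> exists2 P, minimal_point T P & d%:Z * x = f - P.1 * a%:Z - P.2 * b%:Z.
Proof.
have symm n : representable a b n <-> ~ representable a b (f - n).
  exact: representable_symmetry.
have outS y : ~ in_int S y <-> representable a b (f - d%:Z * y).
  rewrite in_int_quotP // symm; split; last by tauto.
  exact: contrapT.
split.
  case=> /outS[u [v [u0 v0 E]]] hS.
  have Ex : d%:Z * x = f - u * a%:Z - v * b%:Z by lia.
  exists (u, v) => //; split.
    by split=> //=; rewrite coset_congruence -Ex dvdz_mulr.
  case=> u' v' [/= u'0 v'0]; rewrite coset_congruence => /dvdzP[y Ey] hu hv.
  have dy : d%:Z * (y - x) = (u - u') * a%:Z + (v - v') * b%:Z.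
    by rewrite mulrBr Ex [d%:Z * y]mulrC -Ey; ring.
  have [h|h] := pselect (y = x).
    have h1 : (u - u') * a%:Z = 0 /\ (v - v') * b%:Z = 0.
      have h1 : 0 <= (u - u') * a%:Z by apply: mulr_ge0; lia.
      have h2 : 0 <= (v - v') * b%:Z by apply: mulr_ge0; lia.
      by move: dy; rewrite h subrr mulr0; lia.
    case: h1 => /eqP h1 /eqP h2; move: h1 h2; rewrite !mulf_eq0 => h1 h2.
    by congr pair; lia.
  have : in_int S (y - x).
    apply/in_int_quotP => //; exists (u - u'), (v - v'); split=> //; lia.
  case=> s Ss Es; have : in_int S y.
    have -> : y = x + s%:Z by lia.
    by apply: hS => // s0; apply: h; lia.
  suff : ~ in_int S y by [].
  apply/outS; exists u', v'; split=> //; lia.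
case=> -[u v] /= hP Ex.
have [/= ud vd] := minimal_point_bounded (d_gt0 : 0 < d%:Z) hP.
have [[/= u0 v0 _] hmin] := hP.
split; first by apply/outS; exists u, v; split=> //; lia.
move=> s Ss s0; apply: contrapT => /outS[u' [v' [u'0 v'0 E]]].
have /in_int_quotP : in_int S s%:Z by exists s.
case/(_ a_gt0 b_gt0 d_gt0) => g1 [g2 [g10 g20 Es]].
(* Both (u, v) and (u' + g1, v' + g2) represent f - d x, and the first is reduced. Hence (u', v') is
   a coset point below (u, v), and minimality will force s = 0. *)
have [e1 e2] : u = u' + g1 /\ v = v' + g2.
  apply: (@representation_unique a b) => //; try lia.
have [] : (u', v') = (u, v).
  apply: hmin => /=; [|lia|lia].
  split=> //=; rewrite coset_congruence.
  have -> : f - u' * a%:Z - v' * b%:Z = d%:Z * (x + s%:Z) by lia.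
  exact: dvdz_mulr.
move=> h1 h2; have g1z : g1 = 0 by lia.
have g2z : g2 = 0 by lia.
by move: Es; rewrite g1z g2z !mul0r addr0 => /eqP; rewrite mulf_eq0; lia.
Qed.

End PseudoFrobenius.

(** * Signs of the approximation errors *)

Section ContinuedFraction.

Variables (c : nat -> nat) (m d r : nat).
Hypothesis cf : cf_expansion (m%:R / d%:R) r c.

(* [cf_num n] and [cf_den n] are p_(n-1) and q_(n-1), and
   [cf_error n] is (-1)^(n-1) d delta_(n-1), starting from n = 0. *)
Definition cf_num n : int := (cf_rec 0 1 c n.+1)%:Z.
Definition cf_den n : int := (cf_rec 1 0 c n.+1)%:Z.
Definition cf_error n : int := cf_den n * m%:Z - cf_num n * d%:Z.
Definition cf_tail k n : rat := foldr (fun x v => x%:R + v^-1) 0 [seq c i | i <- iota k n].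

Lemma cf_denS n : cf_den n.+2 = (c n.+1)%:Z * cf_den n.+1 + cf_den n.
Proof. by rewrite /cf_den /= PoszD PoszM. Qed.

Lemma cf_numS n : cf_num n.+2 = (c n.+1)%:Z * cf_num n.+1 + cf_num n.
Proof. by rewrite /cf_num /= PoszD PoszM. Qed.

Lemma cf_errorS n : cf_error n.+2 = (c n.+1)%:Z * cf_error n.+1 + cf_error n.
Proof. by rewrite /cf_error cf_denS cf_numS; ring. Qed.

Lemma cf_tailS k n : cf_tail k n.+1 = (c k)%:R + (cf_tail k.+1 n)^-1.
Proof. by []. Qed.

Lemma cf_tail_ge0 k n : 0 <= cf_tail k n.
Proof. by elim: n k => // n IH k; rewrite cf_tailS addr_ge0 ?invr_ge0. Qed.

Lemma cf_tail_gt0 k n : (0 < c k)%N -> 0 < cf_tail k n.+1.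
Proof. by move=> h; rewrite cf_tailS ltr_wpDr ?invr_ge0 ?cf_tail_ge0 // ltr0n. Qed.

Lemma cf_partial_gt0 k : (1 <= k <= r.+1)%N -> (0 < c k)%N.
Proof.
case: cf => _ h1 h2 _ hk; have [->|hk'] := eqVneq k r.+1; first by rewrite h2.
by apply: h1; lia.
Qed.

Hypothesis d_gt0 : (0 < d)%N.

(** The ratio of consecutive errors is minus the inverse of a complete quotient, which is positive
    while nonempty; this makes the signs alternate. At k = r + 1 the empty tail has inverse 0, in
    accordance with p_(r+1)/q_(r+1) = alpha. *)
Lemma cf_error_tail k : (k <= r.+1)%N ->
  (cf_error k.+1)%:~R = - (cf_tail k.+1 (r.+1 - k))^-1 * (cf_error k)%:~R :> rat.
Proof.
have d0 : d%:R != 0 :> rat by rewrite pnatr_eq0; lia.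
elim: k => [|k IH] hk.
  case: cf => c0 _ _ /(congr1 (fun x => x * d%:R)); rewrite divfK //.
  rewrite /cf_value /mkseq -/(cf_tail 0 r.+2) cf_tailS c0 add0r subn0 => E.
  rewrite /cf_error /cf_den /cf_num /= c0.
  have -> : (1%N%:Z * m%:Z - 0%N%:Z * d%:Z)%:~R = m%:R :> rat.
    by rewrite mul0r subr0 mul1r.
  have -> : (0%N%:Z * m%:Z - 1%N%:Z * d%:Z)%:~R = - d%:R :> rat.
    by rewrite mul0r sub0r mul1r mulrNz.
  by rewrite mulrN mulNr opprK -E.
have {}IH := IH (ltnW hk).
have e1 : (r.+1 - k = (r.+1 - k.+1).+1)%N by lia.
rewrite e1 in IH; have t0 : cf_tail k.+1 (r.+1 - k.+1).+1 != 0.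
  by apply/lt0r_neq0/cf_tail_gt0/cf_partial_gt0; lia.
have E : (cf_error k)%:~R = - (cf_tail k.+1 (r.+1 - k.+1).+1) * (cf_error k.+1)%:~R :> rat.
  by rewrite IH mulrA mulrNN divff // mul1r.
rewrite cf_errorS intrD intrM E cf_tailS; ring.
Qed.

Lemma cf_error_sign k : (k <= r)%N ->
  (cf_error k < 0 -> 0 < cf_error k.+1) /\ (0 < cf_error k -> cf_error k.+1 < 0).
Proof.
move=> hk; have := @cf_error_tail k ltac:(lia).
have -> : (r.+1 - k = (r - k).+1)%N by lia.
have t0 : 0 < (cf_tail k.+1 (r - k).+1)^-1.
  by rewrite invr_gt0 cf_tail_gt0 // cf_partial_gt0 //; lia.
move=> E; rewrite -(ltr0z rat (cf_error k.+1)) -(ltrz0 rat (cf_error k.+1)) E mulNr.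
rewrite oppr_gt0 oppr_lt0 pmulr_rlt0 // pmulr_rgt0 //.
by rewrite ltr0z ltrz0.
Qed.

Lemma cf_error0 : cf_error 0 = - d%:Z.
Proof. by rewrite /cf_error /cf_den /cf_num /=; ring. Qed.

Lemma cf_error_signs k :
  ((k.*2 <= r.+1)%N -> cf_error k.*2 < 0) /\
  ((k.*2.+1 <= r.+1)%N -> 0 < cf_error k.*2.+1).
Proof.
elim: k => [|k [_ IH]].
  have h : cf_error 0 < 0 by rewrite cf_error0; lia.
  by split=> [//|hr]; apply: (cf_error_sign _).1.
have h : (k.+1.*2 <= r.+1)%N -> cf_error k.+1.*2 < 0.
  by move=> hk; rewrite doubleS; apply: (cf_error_sign _).2; [|apply: IH]; lia.
by split=> // hk; apply: (cf_error_sign _).1; [|apply: h]; lia.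
Qed.

Lemma cf_error_lattice n : (d%:Z %| cf_error n - m%:Z * cf_den n)%Z.
Proof. by apply/dvdzP; exists (- cf_num n); rewrite /cf_error; ring. Qed.

Lemma cf_deltaE k : (-1) ^+ k * cf_delta (m%:R / d%:R) c k = (cf_error k.+1)%:~R / d%:R.
Proof.
have d0 : d%:R != 0 :> rat by rewrite pnatr_eq0; lia.
rewrite /cf_delta mulrA -exprMn mulrNN mulr1 expr1n mul1r.
by rewrite /cf_error /cf_q /cf_p intrB !intrM; field.
Qed.

End ContinuedFraction.

(** * Normalised digits, cardinality and evaluation of the records *)

Definition truncated_digits (r : nat) (e : nat -> nat) (n : nat) : nat :=
  if (1 <= n <= r)%N then e n else 0%N.

Lemma sum_truncated_digits (r n : nat) (e : nat -> nat) (F : nat -> int) :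
  (n <= r.+1)%N ->
  \sum_(i < n) (truncated_digits r e i)%:Z * F i = \sum_(1 <= i < n) (e i)%:Z * F i.
Proof.
case: n => [|n] hn; first by rewrite big_ord0 big_geq.
rewrite -(big_mkord xpredT (fun i => (truncated_digits r e i)%:Z * F i)) big_ltn //.
rewrite mul0r add0r; apply: eq_big_nat => i hi.
by rewrite /truncated_digits; have -> : (1 <= i <= r)%N by lia.
Qed.

Lemma sum_truncated_digits_all (r n : nat) (e : nat -> nat) (F : nat -> int) :
  (r < n)%N ->
  \sum_(i < n) (truncated_digits r e i)%:Z * F i = \sum_(1 <= i < r.+1) (e i)%:Z * F i.
Proof.
elim: n => // n IH; rewrite ltnS leq_eqVlt => /orP[/eqP<-|h].
  exact: sum_truncated_digits.
rewrite big_ord_recr IH //= /truncated_digits.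
by have -> : (1 <= n <= r)%N = false; [lia | rewrite mul0r addr0].
Qed.

Lemma card_eq_uniq_seq (T : eqType) (s : seq T) : uniq s -> ([set` s] #= `I_(size s))%card.
Proof.
case: s => [|x s] us; first by rewrite II0 set_nil.
have -> : [set` x :: s] = nth x (x :: s) @` `I_(size (x :: s)).
  apply/seteqP; split=> y /=.
    by move=> /(nthP x)[i hi <-]; exists i.
  by case=> i hi <-; apply: mem_nth.
apply: inj_card_eq => i j; rewrite !inE => hi hj /eqP.
by rewrite nth_uniq // => /eqP.
Qed.

Lemma fracpart_nat (n d : nat) : (0 < d)%N -> fracpart (n%:R / d%:R) = (n %% d)%:R / d%:R.
Proof.
move=> d0; have d0' : 0 < d%:R :> rat by rewrite ltr0n.
have E : n%:R / d%:R = (n %/ d)%:R + (n %% d)%:R / d%:R :> rat.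
  by rewrite [in LHS](divn_eq n d) natrD natrM mulrDl mulfK // lt0r_neq0.
rewrite /fracpart (@floor_def _ _ (n %/ d)%:Z); first by rewrite E addrC addKr.
rewrite E intrD lerDl ltrD2l divr_ge0 //= ltr_pdivrMr // mul1r ltr_nat.
exact: ltn_pmod.
Qed.

Theorem theorem7 (a b d m r : nat) (c e : nat -> nat) :
  let S : set nat := semigroup_quot (gen2 a b) d in
  let f : int := a%:Z * b%:Z - a%:Z - b%:Z in
  let alpha : rat := m%:R / d%:R in
  let p := cf_p c in
  let q := cf_q c in
  let tau : rat := (a%:R * m%:R + b%:R) / d%:R in
  let mu (i : nat) : rat := tau * (q i)%:R - a%:R * (p i)%:R in
  let beta : rat := 1 - fracpart ((b%:R - 1 + m%:R) / d%:R) in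
  let B : set nat := [set i | (1 <= i <= r./2)%N /\ e (2 * i)%N <> 0%N] in
  let f1 : rat := f%:~R / d%:R - a%:R * (1 - beta) in
  let f2 : rat := f%:~R / d%:R
    - b%:R / d%:R * \sum_(1 <= i < r.+1) (e i)%:R * (q i.-1)%:R in
  (0 < a)%N -> (0 < b)%N -> (0 < d)%N ->
  coprime a b -> coprime a d -> coprime b d ->
  (d < minn a b)%N ->
  ~ (d%:Z %| f)%Z ->
  (1 <= m <= d.-1)%N ->
  (a * m + b = 0 %[mod d])%N ->
  cf_expansion alpha r c ->
  alpha_numeration alpha r c beta e ->
  [set (x%:~R : rat) | x in PF S] =
    [set f1; f2] `|`
    [set y : rat | exists k j : nat,
       [/\ B k, (j < e (2 * k))%N &
           y = f%:~R / d%:R + a%:R * beta - j%:R * mu (2 * k).-1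
               - \sum_(1 <= i < (2 * k)%N) (e i)%:R * mu i.-1]]
  /\ (PF S #= `I_(2 + \sum_(1 <= k < (r./2).+1) e (2 * k))%N)%card.
Proof.
move=> S f alpha p q tau mu beta B f1 f2 a0 b0 d0 cab cad cbd dab _ hm hmod cf [adm num].
have dQ : d%:R != 0 :> rat by rewrite pnatr_eq0; lia.
(* The integer d beta, which lies in 1, ..., d. *)
pose beta' : int := d%:Z - ((b + m - 1) %% d)%N%:Z.
have rem_lt : ((b + m - 1) %% d < d)%N by rewrite ltn_mod.
have beta'_gt0 : 0 < beta' by rewrite /beta'; lia.
have betaE : beta = beta'%:~R / d%:R.
  have e1 : b%:R - 1 + m%:R = (b + m - 1)%:R :> rat.
    by rewrite natrB ?natrD; [ring | lia].
  rewrite /beta e1 fracpart_nat // /beta' intrB; field.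
  exact: dQ.
(* Values of [e] outside 1, ..., r are arbitrary; the staircase requires them to be 0. *)
pose e' := truncated_digits r e.
pose w := cf_error c m d.
pose Q := cf_den c.
have beta'E : beta' = \sum_(i < r.+1) (e' i)%:Z * w i.
  rewrite sum_truncated_digits //; apply: (@intr_inj rat).
  have -> : beta'%:~R = beta * d%:R by rewrite betaE divfK.
  rewrite num mulr_suml rmorph_sum /=; apply: eq_big_nat => -[//|i] _ /=.
  transitivity ((e i.+1)%:R * ((-1) ^+ i * cf_delta alpha c i) * d%:R); first by ring.
  by rewrite cf_deltaE // intrM mulrA divfK.
have e'0 : e' 0%N = 0%N by [].
have e'_out n : (r < n)%N -> e' n = 0%N.
  by rewrite /e' /truncated_digits; case: ifP => //; lia.
have e'_in n : (1 <= n <= r)%N -> e' n = e n by rewrite /e' /truncated_digits => ->.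
have e'_le n : (e' n <= c n)%N.
  by rewrite /e' /truncated_digits; case: ifP => // /adm[].
have e'_zero j : (1 <= j <= r)%N -> e j = 0%N ->
    (forall i, (j <= i)%N -> e' i = 0%N) \/ (2 <= j)%N /\ e j.-1 = c j.-1.
  move=> hj ej; have [_ /(_ ej)[h|h]] := adm j hj; last by right.
  left=> i hi; rewrite /e' /truncated_digits; case: ifP => // hi2; apply: h; lia.
(* No digit precedes the first, so by admissibility a zero there makes all digits vanish,
   contradicting beta > 0. *)
have e'1 : (0 < e' 1)%N.
  rewrite lt0n; apply/negP => /eqP e10.
  have hz i : e' i = 0%N.
    have [->//|i0] := posnP i; have [hr|hr] := leqP 1 r; last by apply: e'_out; lia.
    rewrite e'_in in e10; last by [].
    by case: (@e'_zero 1%N hr e10) => [h|[]//]; apply: h.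
  move: beta'_gt0; rewrite beta'E big1 ?ltxx // => i _.
  by rewrite hz mul0r.
have e'_adm j : (1 <= j <= r)%N -> e' j = 0%N ->
    (forall i, (j <= i)%N -> e' i = 0%N) \/ e' j.-1 = c j.-1.
  move=> hj; rewrite e'_in // => ej; case: (e'_zero j hj ej) => [|[j2 h]]; [by left|right].
  by rewrite e'_in //; lia.
pose L := last_record beta' e' w Q 0 ::
  rcons (records beta' e' w Q r./2) (ladder beta' e' w Q (r./2).+1 0).
have dZ : 0 < d%:Z by lia.
have Q0 : Q 0%N = 0 by [].
have Q1 : Q 1%N = 1 by rewrite /Q /cf_den /= muln0.
have QS n : Q n.+2 = (c n.+1)%:Z * Q n.+1 + Q n by exact: cf_denS.
have wS n : w n.+2 = (c n.+1)%:Z * w n.+1 + w n by exact: cf_errorS.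
have w_lat n : (d%:Z %| w n - m%:Z * Q n)%Z by exact: cf_error_lattice.
have w_even k : (k.*2 <= r.+1)%N -> w k.*2 < 0 by case: (cf_error_signs cf d0 k).
have w_odd k : (k.*2.+1 <= r.+1)%N -> 0 < w k.*2.+1 by case: (cf_error_signs cf d0 k).
have c_gt0 n : (1 <= n <= r)%N -> (0 < c n)%N.
  by move=> hn; apply: (cf_partial_gt0 cf); lia.
have w0 : w 0%N = - d%:Z by exact: cf_error0.
have minE P : minimal_point (coset_points d%:Z m%:Z beta') P <-> P \in L.
  by apply: (@minimal_pointsE d%:Z m%:Z beta' r c e' w Q).
have uniqL : uniq L by apply: (@minimal_points_uniq d%:Z m%:Z beta' r c e' w Q).
have m_def : (d%:Z %| a%:Z * m%:Z + b%:Z)%Z.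
  by rewrite -PoszM -PoszD dvdzE !absz_nat /dvdn hmod mod0n.
have beta'_def : (d%:Z %| beta' + b%:Z - 1 + m%:Z)%Z.
  apply/dvdzP; exists (1 + ((b + m - 1) %/ d)%N%:Z).
  by have := divn_eq (b + m - 1) d; rewrite /beta'; lia.
have da : (d < a)%N by lia.
have db : (d < b)%N by lia.
have PFE x : PF S x <-> exists2 P, P \in L & d%:Z * x = f - P.1 * a%:Z - P.2 * b%:Z.
  rewrite (@PF_minimal_point a b d m beta') //.
  by split=> -[P /minE hP E]; exists P.
have divL P : P \in L -> (d%:Z %| f - P.1 * a%:Z - P.2 * b%:Z)%Z.
  by move=> /minE[[_ _]]; rewrite (@coset_congruence a b).
pose pf P : int := ((f - P.1 * a%:Z - P.2 * b%:Z) %/ d%:Z)%Z.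
have pfL P : P \in L -> d%:Z * pf P = f - P.1 * a%:Z - P.2 * b%:Z.
  by move=> hP; rewrite mulrC divzK // divL.
have PF_pf : PF S = pf @` [set` L].
  apply/seteqP; split=> [x /PFE[P hP E]|x /= [P hP <-]].
    by exists P => //; apply: (mulfI (lt0r_neq0 dZ)); rewrite pfL.
  by apply/PFE; exists P => //; apply: pfL.
split; last first.
  rewrite PF_pf; apply: (card_eq_trans (B := [set` L])).
    (* Distinct points give distinct numbers, since f - d x has only one reduced representation. *)
    apply: inj_card_eq => P P'; rewrite !inE => hP hP' E.
    have := pfL _ hP; rewrite E pfL // => {}E.
    have [[P1 P2 _] _] := (minE P).2 hP; have [[P1' P2' _] _] := (minE P').2 hP'.
    have [h1 h2] := minimal_point_bounded dZ ((minE P).2 hP).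
    case: P P' {hP hP'} E P1 P2 P1' P2' h1 h2 => [u v] [u' v'] /= *.
    have [-> ->//] : u = u' /\ v = v' by apply: (@representation_unique a b) => //; lia.
  have <- : (\sum_(1 <= k < (r./2).+1) e' k.*2 = \sum_(1 <= k < (r./2).+1) e (2 * k))%N.
    by apply: eq_big_nat => k hk; rewrite e'_in ?mul2n //; lia.
  by rewrite -(size_minimal_points beta' r e' w Q); apply: card_eq_uniq_seq.
pose val (P : int * int) : rat :=
  (f%:~R - P.1%:~R * a%:R - P.2%:~R * b%:R) / d%:R.
have valE P : P \in L -> (pf P)%:~R = val P.
  move=> hP; apply: (mulfI dQ); rewrite [RHS]mulrC divfK //.
  have /(congr1 (fun z : int => z%:~R : rat)) := pfL _ hP.
  by rewrite intrM !intrB !intrM.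
have -> : [set (x%:~R : rat) | x in PF S] = val @` [set` L].
  rewrite PF_pf; apply/seteqP; split=> y /=.
    by case=> x [P hP <-] <-; exists P; rewrite ?valE.
  by case=> P hP <-; exists (pf P); [exists P | rewrite valE].
(* So mu_i is the value at the lattice vector (w_(i+1), Q_(i+1)) of the form (u, v) -> (ua + vb)/d
   that [val] subtracts from f/d. *)
have muE i : mu i = (b%:R * (Q i.+1)%:~R + a%:R * (w i.+1)%:~R) / d%:R.
  by rewrite /mu /tau /w /Q /cf_error /cf_den /p /q /cf_p /cf_q intrB !intrM; field.
have val_first : val (last_record beta' e' w Q 0) = f1.
  have -> : last_record beta' e' w Q 0 = (d%:Z - beta', 0).
    rewrite /last_record w0 Q0 /abscissa /ordinate !big_ord_recl !big_ord0 e'0.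
    by congr pair; ring.
  by rewrite /val /= /f1 betaE intrB; field.
have val_last : val (ladder beta' e' w Q (r./2).+1 0) = f2.
  rewrite /val /= !mul0r !addr0 (abscissa_end e'_out beta'E); last by lia.
  rewrite /ordinate sum_truncated_digits_all; last by lia.
  rewrite mul0r subr0 /f2 mulrBl [in RHS]mulrAC; congr (_ - _ / _).
  rewrite [RHS]mulrC rmorph_sum; congr (_ * _).
  by apply: eq_big_nat => -[//|i] _; rewrite /= intrM.
have val_ladder k j : (1 <= k <= r./2)%N -> val (ladder beta' e' w Q k j) =
    f%:~R / d%:R + a%:R * beta - j%:R * mu (2 * k).-1
      - \sum_(1 <= i < (2 * k)%N) (e i)%:R * mu i.-1.
  move=> hk; rewrite mul2n.
  have -> : \sum_(1 <= i < k.*2) (e i)%:R * mu i.-1 =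
      (b%:R * (\sum_(1 <= i < k.*2) (e i)%:Z * Q i)%:~R
       + a%:R * (\sum_(1 <= i < k.*2) (e i)%:Z * w i)%:~R) / d%:R.
    rewrite !rmorph_sum !mulr_sumr -big_split mulr_suml /=.
    by apply: eq_big_nat => -[//|i] _; rewrite muE /= !intrM; field.
  rewrite muE prednK; last by lia.
  rewrite /val /ladder /abscissa /ordinate !sum_truncated_digits; try lia.
  rewrite /= betaE; generalize beta' f (w k.*2) (Q k.*2)
    (\sum_(1 <= i < k.*2) (e i)%:Z * w i) (\sum_(1 <= i < k.*2) (e i)%:Z * Q i).
  by move=> *; rewrite !intrD !intrM intrN; field.
apply/seteqP; split=> y /=.
  case=> P; rewrite inE mem_rcons inE => /orP[/eqP->|/orP[/eqP->|hP]] <-.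
  - by left; left.
  - by left; right.
  case/allpairsPdep: hP => k [j []]; rewrite !mem_iota => hk hj ->; right.
  have hk1 : (1 <= k <= r./2)%N by lia.
  have ek : e' k.*2 = e (2 * k)%N by rewrite e'_in ?mul2n //; lia.
  (* Membership of k in [B] follows from j < e_2k. *)
  exists k, j; rewrite val_ladder //; split=> //; last by rewrite -ek; lia.
  by split=> //; rewrite -ek; lia.
case=> [[->|->]|].
- by exists (last_record beta' e' w Q 0); rewrite ?inE ?eqxx.
- by exists (ladder beta' e' w Q (r./2).+1 0); rewrite ?inE ?mem_rcons ?inE ?eqxx ?orbT.
case=> k [j [[hk _] hj ->]]; exists (ladder beta' e' w Q k j); last exact: val_ladder.
rewrite inE mem_rcons inE; apply/orP; right; apply/orP; right.
apply/allpairsPdep; exists k, j; split=> //; rewrite mem_iota; first by lia.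
by rewrite e'_in ?mul2n //= -?mul2n //; lia.
Qed.
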